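(* Let $G=(V,E)$ be a finite simple graph. The Wavefront algorithm (described in the context) applied to $G$ returns the zero forcing number $Z(G)$.
   Context: For $v\in V$, $N(v)$ is the neighborhood of $v$ and $N[v]=N(v)\cup\{v\}$; $n=|V|$. Zero forcing color change rule: a colored vertex with exactly one uncolored neighbor forces that neighbor to become colored. The closure $\mathrm{cl}(S)$ of $S\subseteq V$ is the set of colored vertices obtained from $S$ by applying the rule until no further vertex can be forced. A zero forcing set is a set $S$ with $\mathrm{cl}(S)=V$, and $Z(G)$ is the minimum cardinality of a zero forcing set. Wavefront algorithm: initialize $\mathcal{C}\leftarrow\{(\emptyset,0)\}$. For $R=1,2,\dots,n$: for each $(S,r)\in\mathcal{C}$: for each $v\in V$: set $S'\leftarrow \mathrm{cl}(S\cup N[v])$ and $r'\leftarrow r+|\{v\}\setminus S|+\max\{|N(v)\setminus S|-1,0\}$; if $r'\le R$ and there is no pair $(S',i)\in\mathcal{C}$ with $i\le R$, then add $(S',r')$ to $\mathcal{C}$, and if moreover $S'=V$, return $r'$. *)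

(* Defs.v *)
(* MathComp. *)
From mathcomp Require Import all_boot.

Set Implicit Arguments.
Unset Strict Implicit.
Unset Printing Implicit Defensive.

Section ZeroForcing.
Variables (T : finType) (E : rel T).
Implicit Types (S X Y : {set T}) (u v w : T).

Definition nbhd v : {set T} := [set w | E v w].
Definition cnbhd v : {set T} := v |: nbhd v.

Definition forces S u w : bool := (u \in S) && (nbhd u :\: S == [set w]).

Definition forceable S w : bool := [exists u, forces S u w].

Definition force1 S : {set T} :=
  if [pick w | forceable S w] is Some w then w |: S else S.

(* One vertex is forced at a time, the choice being made by [pick]; each
   effective step adds a vertex, so #|T| steps are enough to stall. By [clP]
   the result does not depend on the order in which forces are performed. *)
Definition cl S : {set T} := iter #|T| force1 S.

Inductive forcing_run S : {set T} -> Prop :=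
| run_refl : forcing_run S S
| run_step X w : forcing_run S X -> forceable X w -> forcing_run S (w |: X).

Definition stalled S : Prop := forall w, ~~ forceable S w.

Lemma forceableN S w : forceable S w -> w \notin S.
Proof.
case/existsP=> u /andP[_ /eqP/setP/(_ w)].
by rewrite !inE eqxx => /andP[].
Qed.

Lemma force1_run S X : forcing_run S X -> forcing_run S (force1 X).
Proof.
by move=> SX; rewrite /force1; case: pickP => // w; apply: run_step.
Qed.

Lemma force1_stalled S : force1 S = S -> stalled S.
Proof.
rewrite /force1; case: pickP => [w fw eqS | nf _ w]; last by rewrite nf.
by case/negP: (forceableN fw); rewrite -eqS !inE eqxx.
Qed.

Lemma cl_run S : forcing_run S (cl S).
Proof.
rewrite /cl; elim: #|T| => [|k IHk] /=; first exact: run_refl.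
exact: force1_run.
Qed.

Lemma force1_cases S : force1 S = S \/ #|force1 S| = #|S|.+1.
Proof.
rewrite /force1; case: pickP => [w fw|_]; last by left.
by right; rewrite cardsU1 (forceableN fw).
Qed.

Lemma cl_stalled S : stalled (cl S).
Proof.
apply: force1_stalled.
have grow k : force1 (iter k force1 S) = iter k force1 S \/
    k <= #|iter k force1 S|.
  elim: k => [|k [IHk|IHk]]; [by right | by left; rewrite /= !IHk |].
  case: (force1_cases (iter k force1 S)) => [eqX|eqX].
    by left; rewrite /= !eqX.
  by right; rewrite /= eqX.
case: (grow #|T|) => // leT; rewrite -/(cl S) in leT *.
case: (force1_cases (cl S)) => // eqX.
by have := max_card (force1 (cl S)); rewrite eqX leqNgt ltnS leT.
Qed.

Lemma run_sub_stalled S X Y :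
  S \subset Y -> stalled Y -> forcing_run S X -> X \subset Y.
Proof.
move=> SY stY; elim=> // {}X w _ XY /existsP[u /andP[uX /eqP Nu]].
rewrite subUset sub1set XY andbT; apply/negPn/negP => wY.
case/negP: (stY w); apply/existsP; exists u; rewrite /forces (subsetP XY) //=.
apply/eqP/setP => z; move/setP: Nu => /(_ z); rewrite !inE.
case: (eqVneq z w) => [->|_]; first by rewrite wY => /andP[].
by have /subsetP/(_ z) := XY; case: (z \in X) => [->|_ /= ->] //; rewrite andbF.
Qed.

Lemma run_sub S X : forcing_run S X -> S \subset X.
Proof.
by elim=> // {}X w _ SX _; apply: subset_trans SX (subsetUr _ _).
Qed.

Lemma clP S X : (forcing_run S X /\ stalled X) <-> X = cl S.
Proof.
split=> [[rX sX] | ->]; last by split; [apply: cl_run | apply: cl_stalled].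
apply/eqP; rewrite eqEsubset; apply/andP; split.
  exact: run_sub_stalled (run_sub (cl_run S)) (cl_stalled S) rX.
exact: run_sub_stalled (run_sub rX) sX (cl_run S).
Qed.

Definition zero_forcing S : bool := cl S == setT.

Lemma zero_forcingT : zero_forcing setT.
Proof. by rewrite /zero_forcing -subTset (run_sub (cl_run _)). Qed.

(* The default value [setT] is legitimate by [zero_forcingT]. *)
Definition zero_forcing_number : nat :=
  #|[arg min_(S < [set: T] | zero_forcing S) #|S|]|.

Definition entry : Type := ({set T} * nat)%type.

Variant state := Running of seq entry | Returned of nat.

Definition new_cost S r v : nat :=
  r + #|[set v] :\: S| + maxn (#|nbhd v :\: S| - 1) 0.

Definition visit (R : nat) (p : entry) (st : state) (v : T) : state :=
  if st is Running C then
    let: (A, r) := p in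
    let A' := cl (A :|: cnbhd v) in
    let r' := new_cost A r v in
    if (r' <= R) && ~~ has (fun q : entry => (q.1 == A') && (q.2 <= R)) C then
      if A' == setT then Returned r' else Running ((A', r') :: C)
    else st
  else st.

(* The loops "for each (S, r) in C" and "for each v in V" do not specify an
   order: [ordC R C] is the order in which the entries present in C when
   round R starts are scanned, and [ordV R p] the order in which the vertices
   are visited while p is scanned in round R. Entries added during round R are
   first scanned in round R+1; they cost exactly R and every proper extension
   costs at least 1, so scanning them in round R already would add nothing. *)
Definition round (ordC : nat -> seq entry -> seq entry)
    (ordV : nat -> entry -> seq T) (st : state) (R : nat) : state :=
  if st is Running C then
    foldl (fun st' p => foldl (visit R p) st' (ordV R p)) st (ordC R C)
  else st.

(* [None] means that all rounds end without executing "return". *)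
Definition wavefront (ordC : nat -> seq entry -> seq entry)
    (ordV : nat -> entry -> seq T) : option nat :=
  if foldl (round ordC ordV) (Running [:: (set0, 0)]) (iota 1 #|T|)
    is Returned r then Some r else None.

End ZeroForcing.

(* Main.v *)
Require Import Defs.
From mathcomp Require Import all_boot.

(** After round [R] the table is sound (an entry [(S, r)] satisfies [S = cl Z]
    for some [Z] with at most [r] elements) and saturated (any extension of an
    entry at cost at most [R] is recorded at that cost or less).  Saturation
    survives a round because a step of cost 0 from a closed set goes nowhere,
    so every entry added in round [R] costs exactly [R].  A forcing run from
    a zero forcing set [Z] is then simulated by adding the closed neighbourhood
    of each forcing vertex: writing [(S, r)] for the entry reached, the
    potential [r + #|Z :\: S|] never increases, since the vertices paid for
    belong to [Z].  Hence a saturated table at level [#|Z|] contains the whole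
    vertex set. *)

Set Implicit Arguments.
Unset Strict Implicit.
Unset Printing Implicit Defensive.

Section Wavefront.
Variables (V : finType) (E : rel V).
Implicit Types (S X Y Z : {set V}) (u v w : V) (C : seq (entry V)).
Implicit Types (p q : entry V) (R r : nat).

Local Notation cl := (cl E).
Local Notation stalled := (stalled E).
Local Notation nbhd := (nbhd E).
Local Notation cnbhd := (cnbhd E).

(** * Closure and free steps *)

Lemma sub_cl S : S \subset cl S.
Proof. exact: run_sub (cl_run E S). Qed.

Lemma cl_min S Y : S \subset Y -> stalled Y -> cl S \subset Y.
Proof. by move=> SY stY; apply: run_sub_stalled SY stY (cl_run E S). Qed.

Lemma clS S Y : S \subset Y -> cl S \subset cl Y.
Proof.
by move=> SY; apply: cl_min (cl_stalled _ _); apply: subset_trans (sub_cl _).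
Qed.

Lemma cl_stalled_id S : stalled S -> cl S = S.
Proof. by move=> stS; apply/eqP; rewrite eqEsubset sub_cl cl_min. Qed.

Definition step_set S v := cl (S :|: cnbhd v).

(** A visit at no extra cost has [v] in [S] and at most one neighbour of [v] outside [S]; a single
    one would be forceable, contradicting [stalled S]. *)
Lemma step_set_free S r v :
  stalled S -> new_cost E S r v <= r -> step_set S v = S.
Proof.
rewrite /new_cost maxn0 -addnA -{2}[r]addn0 leq_add2l leqn0 addn_eq0 cards_eq0.
rewrite subn_eq0 => stS /andP[]; rewrite setD_eq0 sub1set => vS Nv.
suff /setUidPl NS: cnbhd v \subset S by rewrite /step_set NS cl_stalled_id.
rewrite subUset sub1set vS /= -setD_eq0.
move: Nv; rewrite leq_eqVlt => /orP[/cards1P[w Nw]|]; last first.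
  by rewrite ltnS leqn0 cards_eq0.
by case/negP: (stS w); apply/existsP; exists v; rewrite /forces vS Nw eqxx.
Qed.

(** * Soundness of the entries *)

Definition generated q := exists2 Z : {set V}, #|Z| <= q.2 & q.1 = cl Z.

Lemma generated_stalled q : generated q -> stalled q.1.
Proof. by case=> Z _ ->; apply: cl_stalled. Qed.

(** The cost pays for [v], if it is outside [cl Z], and for all but one of its neighbours outside.
    Once these are added to [Z], the vertex [v] forces the last one. *)
Lemma generated_step S r v :
  generated (S, r) -> generated (step_set S v, new_cost E S r v).
Proof.
case=> Z /= Zr ->; set A := cl Z.
have AN Y : Y \subset cnbhd v -> Z :|: Y \subset A :|: cnbhd v.
  by move=> YN; rewrite setUSS ?sub_cl.
have ANcl Y : Z \subset Y -> cnbhd v \subset cl Y -> A :|: cnbhd v \subset cl Y.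
  by move=> ZY vY; rewrite subUset vY andbT clS.
have gen Y : Y \subset cnbhd v -> cnbhd v \subset cl (Z :|: Y) ->
    #|Y| <= #|[set v] :\: A| + maxn (#|nbhd v :\: A| - 1) 0 ->
  generated (step_set A v, new_cost E A r v).
  move=> YN NY cY; exists (Z :|: Y).
    rewrite /= /new_cost -addnA; apply: leq_trans (leq_add Zr cY).
    by rewrite cardsU leq_subr.
  apply/eqP; rewrite eqEsubset (clS (AN _ YN)) andbT.
  by apply: cl_min (cl_stalled _ _); apply: ANcl NY; apply: subsetUl.
have inA Y x : x \in A -> x \in cl (Z :|: Y).
  by apply/subsetP/clS/subsetUl.
(* In the second case [w] is the neighbour left unpaid, to be forced by [v]. *)
case: (set_0Vmem (nbhd v :\: A)) => [N0 | [w wN]].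
  apply: (gen ([set v] :\: A)).
  - by apply: subset_trans (subsetDl _ _) (subsetUl _ _).
  - apply/subsetP=> x xN; case xA: (x \in A); first exact: inA.
    move: xN; rewrite !inE => /orP[xv | xN].
      by apply: (subsetP (sub_cl _)); rewrite !inE xA xv orbT.
    by move/setP/(_ x): N0; rewrite !inE xA xN.
  - exact: leq_addr.
apply: (gen (([set v] :\: A) :|: ((nbhd v :\: A) :\ w))).
- apply/subsetP=> x; rewrite !inE => /orP[/andP[_ ->] // | /and3P[_ _ ->]].
  by rewrite orbT.
- set B := cl (Z :|: _).
  have vB : v \in B.
    case vA: (v \in A); first exact: inA.
    by apply: (subsetP (sub_cl _)); rewrite !inE vA eqxx orbT.
  have NB x : E v x -> x != w -> x \in B.
    move=> vx xw; case xA: (x \in A); first exact: inA.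
    by apply: (subsetP (sub_cl _)); rewrite !inE xA vx xw !orbT.
  have stB : stalled B by apply: cl_stalled.
  have wB : w \in B.
    apply/negPn/negP => wB; case/negP: (stB w).
    apply/existsP; exists v; rewrite /forces vB /=.
    apply/eqP/setP => x; rewrite !inE.
    case: (eqVneq x w) => [->|xw].
      by rewrite wB; move: wN; rewrite !inE => /andP[].
    by apply/negP => /andP[]; move=> xB vx; rewrite (NB x) in xB.
  apply/subsetP=> x; rewrite !inE => /orP[/eqP-> // | vx].
  by case: (eqVneq x w) => [-> // | ]; apply: NB.
- rewrite maxn0 (cardsD1 w (nbhd v :\: A)) wN addKn.
  by rewrite cardsU leq_subr.
Qed.

(** * Saturation and simulation of forcing runs *)

Definition recorded C S r := exists2 i, i <= r & (S, i) \in C.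

Definition saturated R C := forall S r v, (S, r) \in C ->
  new_cost E S r v <= R -> recorded C (step_set S v) (new_cost E S r v).

Lemma recordedS C C' S r :
  {subset C <= C'} -> recorded C S r -> recorded C' S r.
Proof. by move=> sCC' [i ir /sCC']; exists i. Qed.

(* [nbhd v] may contain at most one vertex outside [Z :|: S], which is the one
   that comes for free. *)
Lemma new_cost_potential Z S r v :
  irreflexive E -> v \in Z :|: S ->
  #|nbhd v :\: (Z :|: S)| <= 1 ->
  new_cost E S r v + #|Z :\: step_set S v| <= r + #|Z :\: S|.
Proof.
move=> irrE vZS N1; rewrite /new_cost -!addnA leq_add2l addnA maxn0.
have sub : Z :\: step_set S v \subset Z :\: (S :|: cnbhd v).
  exact: setDS (sub_cl _).
apply: leq_trans (leq_add (leqnn _) (subset_leq_card sub)) _.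
rewrite -(cardsID (cnbhd v) (Z :\: S)) setDDl leq_add2r.
(* This uses [vZS]: if [v] is outside [S], it is in [Z], so the cost of [v] is matched by a drop of
   the potential. *)
have -> : (Z :\: S) :&: cnbhd v = ([set v] :\: S) :|: (nbhd v :&: Z :\: S).
  apply/setP=> x; rewrite !inE; case: eqVneq vZS => [->|_ _]; rewrite ?inE.
    by case: (v \in S); case: (v \in Z); case: (E v v).
  by case: (x \in S); case: (x \in Z); case: (E v x).
rewrite cardsU (_ : ([set v] :\: S) :&: _ = set0) ?cards0 ?subn0; last first.
  apply/setP=> x; rewrite !inE; case: (eqVneq x v) => [->|_]; last by rewrite andbF.
  by rewrite irrE !andbF.
(* By [N1], the [- 1] in the cost absorbs the neighbours outside both [S] and [Z]. *)
rewrite leq_add2l leq_subLR addnC; apply: leq_trans (_ : _ <= _ + _) (leq_add (leqnn _) N1).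
rewrite -(cardsID Z (nbhd v :\: S)) setDDl [S :|: Z]setUC leq_add2r.
by rewrite setIDAC.
Qed.

Lemma saturated_full R C Z :
  irreflexive E -> saturated R C -> (set0, 0) \in C ->
  zero_forcing E Z -> #|Z| <= R -> exists r, (setT, r) \in C.
Proof.
move=> irrE satC C0 /eqP ZT ZR.
have step S r v : (S, r) \in C -> r + #|Z :\: S| <= #|Z| ->
    v \in Z :|: S -> #|nbhd v :\: (Z :|: S)| <= 1 ->
  exists2 i, (step_set S v, i) \in C & i + #|Z :\: step_set S v| <= #|Z|.
  move=> SC rZ vZS N1; have le1 := new_cost_potential r irrE vZS N1.
  have le2 := leq_trans le1 rZ.
  have [|i ir iC] := satC S r v SC.
    (* The potential bounds the new cost by [#|Z|], hence by [R], so saturation applies. *)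
    by apply: leq_trans ZR; apply: leq_trans le2; apply: leq_addr.
  by exists i => //; apply: leq_trans le2; rewrite leq_add2r.
have run X : forcing_run E Z X -> exists S, exists2 r,
    (S, r) \in C & r + #|Z :\: S| <= #|Z| /\ X \subset Z :|: S.
  elim=> [|{}X w _ [S [r SC [rZ XZS]]] /existsP[u /andP[uX /eqP Nu]]].
    by exists set0; exists 0; rewrite ?setD0 ?setU0.
  have N1 : #|nbhd u :\: (Z :|: S)| <= 1.
    by rewrite -(cards1 w) -Nu subset_leq_card ?setDS.
  have [i iC iZ] := step S r u SC rZ (subsetP XZS u uX) N1.
  exists (step_set S u); exists i => //; split=> //.
  have sS : S :|: cnbhd u \subset step_set S u by apply: sub_cl.
  rewrite subUset sub1set inE (subsetP sS) ?orbT /=; last first.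
    by move/setP/(_ w): Nu; rewrite !inE eqxx => /andP[_ ->]; rewrite !orbT.
  apply: subset_trans XZS _; rewrite setUS //.
  exact: subset_trans (subsetUl _ _) sS.
have [S [r SC [rZ ZS]]] := run _ (cl_run E Z); rewrite ZT in ZS.
(* The run only gives that [Z] and [S] together cover the graph. The vertices of [Z] missing from
   [S] are now visited one by one, with induction on their number. *)
have [k] := ubnP #|Z :\: S|; elim: k => // k IHk in S r SC rZ ZS *.
rewrite ltnS => Sk; have [ZS0 | [z zZS]] := set_0Vmem (Z :\: S).
  exists r; suff -> : setT = S by [].
  apply/eqP; rewrite eqEsubset subsetT andbT.
  by rewrite (subset_trans ZS) // subUset subxx andbT -setD_eq0 ZS0.
have TZS : Z :|: S = setT by apply/eqP; rewrite -subTset.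
have [||i iC iZ] := step S r z SC rZ; rewrite ?TZS ?inE ?setDT ?cards0 //.
have sS : S :|: cnbhd z \subset step_set S z by apply: sub_cl.
apply: (IHk _ i iC iZ).
  by apply: subset_trans ZS _; rewrite setUS // (subset_trans _ sS) ?subsetUl.
apply: leq_trans Sk; apply: proper_card; apply/properP; split.
  by rewrite setDS // (subset_trans _ sS) ?subsetUl.
by exists z; rewrite // !inE (subsetP sS) // !inE eqxx orbT.
Qed.

(** * Invariants of the rounds *)

(** Reaching [setT] ends the algorithm, so a table still in use omits it; this is what
    [saturated_full] contradicts. *)
Definition valid C := forall q, q \in C -> generated q /\ q.1 != setT.

Definition round_inv R C :=
  [/\ valid C, forall q, q \in C -> q.2 <= R, saturated R C & (set0, 0) \in C].

(** Holds in the middle of round [R.+1], where [C0] is the table at its start. *)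
Definition partial_inv R C0 C := [/\ valid C, {subset C0 <= C}
  & forall q, q \in C -> q \in C0 \/ q.2 = R.+1].

Definition returnable R r := r <= R /\ exists2 Z : {set V}, zero_forcing E Z & #|Z| <= r.

Lemma visit_inv R C0 C p v :
    round_inv R C0 -> p \in C0 -> partial_inv R C0 C ->
  match visit E R.+1 p (Running C) v with
  | Running C' => [/\ partial_inv R C0 C', {subset C <= C'}
      & new_cost E p.1 p.2 v <= R.+1 ->
        recorded C' (step_set p.1 v) (new_cost E p.1 p.2 v)]
  | Returned r => returnable R.+1 r
  end.
Proof.
case: p => A r [vC0 leC0 satC0 _] pC0 [vC sC newC] /=.
rewrite -/(step_set A v); set A' := step_set A v; set r' := new_cost E A r v.
have cost : r' <= R -> recorded C A' r'.
  by move=> rR; apply: recordedS sC _; apply: satC0.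
have [[genA _] rA] := (vC0 _ pC0, generated_step v (proj1 (vC0 _ pC0))).
case: (leqP r' R.+1) => /= [r'R | //]; last by split.
case: hasP => /= [[[S i] iC /= /andP[/eqP SA iR]] | nC].
  (* The blocking entry costs at most [R.+1], which is good enough if [r'] is [R.+1]; a smaller [r']
     was covered by the saturation of [C0]. *)
  split=> // _; move: r'R; rewrite leq_eqVlt => /orP[/eqP r'R | ]; last exact: cost.
  by exists i; rewrite ?r'R // -SA.
case: eqP => [AT | /eqP AT].
  by split=> //; case: rA => Z Zr /= ZA; exists Z => //; apply/eqP; rewrite -ZA.
(* A smaller cost would be recorded already, and that entry would have blocked the addition. *)
have r'E : r' = R.+1.
  apply/eqP; rewrite eqn_leq r'R ltnNge; apply/negP => /cost[i ir iC].
  by case: nC; exists (A', i); rewrite //= eqxx (leq_trans ir r'R).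
split; last by exists r'; rewrite ?mem_head.
- split=> [q|q qC0|q]; rewrite inE.
  + by case/predU1P=> [-> //|]; apply: vC.
  + by rewrite sC ?orbT.
  + by case/predU1P=> [-> //|/newC]; first by right.
- by move=> q qC; rewrite inE qC orbT.
Qed.

Lemma foldl_returned (I : Type) (f : state V -> I -> state V) r s :
  (forall i, f (Returned V r) i = Returned V r) ->
  foldl f (Returned V r) s = Returned V r.
Proof. by move=> fr; elim: s => //= i s; rewrite fr. Qed.

Lemma visits_inv R C0 C (s : seq (entry V * V)) :
    round_inv R C0 -> (forall x, x \in s -> x.1 \in C0) -> partial_inv R C0 C ->
  match foldl (fun st x => visit E R.+1 x.1 st x.2) (Running C) s with
  | Running C' => [/\ partial_inv R C0 C', {subset C <= C'}
      & forall x, x \in s -> new_cost E x.1.1 x.1.2 x.2 <= R.+1 ->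
        recorded C' (step_set x.1.1 x.2) (new_cost E x.1.1 x.1.2 x.2)]
  | Returned r => returnable R.+1 r
  end.
Proof.
move=> inv0; elim: s C => [|[p v] s IHs] C sC0 invC; first by split.
have pC0 : p \in C0 by apply: (sC0 (p, v)); apply: mem_head.
have := visit_inv v inv0 pC0 invC; cbn [foldl fst snd].
case: (visit _ _ _ _ _) => [C1 [inv1 sC1 recp] | r]; last first.
  by rewrite foldl_returned.
have := IHs C1 _ inv1; case: (foldl _ _ _) => [C2|r] IH; last first.
  by apply: IH => x xs; apply: sC0; rewrite inE xs orbT.
have [|inv2 sC2 recs] := IH; first by move=> x xs; apply: sC0; rewrite inE xs orbT.
split=> // [q /sC1/sC2 // | x].
case/predU1P=> [-> /recp | ]; last exact: recs.
exact: recordedS.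
Qed.

(** Flattens the two nested loops of a round, so that [visits_inv] needs a single induction. *)
Lemma foldl_allpairs (I J A : Type) (f : A -> I -> J -> A) a (s : seq I)
    (t : I -> seq J) :
  foldl (fun a i => foldl (fun a => f a i) a (t i)) a s =
  foldl (fun a x => f a x.1 x.2) a [seq (i, j) | i <- s, j <- t i].
Proof.
elim: s a => //= i s IHs a; rewrite foldl_cat IHs; congr foldl.
by elim: (t i) a => //= j u IHu a; apply: IHu.
Qed.

Section Rounds.
Variables (ordC : nat -> seq (entry V) -> seq (entry V)).
Variables (ordV : nat -> entry V -> seq V).
Hypothesis ordC_perm : forall R C, perm_eq (ordC R C) C.
Hypothesis ordV_perm : forall R p, perm_eq (ordV R p) (enum V).

Lemma round_invP R C : round_inv R C ->
  match round E ordC ordV (Running C) R.+1 with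
  | Running C' => round_inv R.+1 C'
  | Returned r => returnable R.+1 r
  end.
Proof.
move=> invC; have [vC leC satC C0] := invC.
rewrite /= (foldl_allpairs (fun st p v => visit E R.+1 p st v)).
set s := [seq _ | _ <- _, _ <- _].
have /= := @visits_inv R C C s invC _ _; case: (foldl _ _ _) => [C'|r] inv'.
  have [||[vC' sC newC'] _ rec] := inv'.
  - by move=> _ /allpairsPdep[p [v [pC _ ->]]]; rewrite -(perm_mem (ordC_perm R.+1 C)).
  - by split=> // q; left.
  split=> //; last exact: sC.
    by move=> q /newC'[/leC/leqW // | ->].
  move=> S r v SC' cR; have [SC | /= rR] := newC' _ SC'.
    apply: (rec ((S, r), v)) cR; apply/allpairsPdep; exists (S, r), v.
    by rewrite (perm_mem (ordC_perm _ _)) (perm_mem (ordV_perm _ _)) mem_enum.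
  (* An entry added in this round costs [R.+1], so an extension within the bound is free and leads
     back to [S]. *)
  have stS := generated_stalled (proj1 (vC' _ SC')).
  rewrite (@step_set_free _ r _ stS); last by rewrite [leqRHS]rR.
  by exists r; rewrite // /new_cost -addnA leq_addr.
apply: inv'; last by split=> // q; left.
by move=> _ /allpairsPdep[p [v [pC _ ->]]]; rewrite -(perm_mem (ordC_perm R.+1 C)).
Qed.

Lemma rounds_invP R C n : irreflexive E -> round_inv R C ->
  match foldl (round E ordC ordV) (Running C) (iota R.+1 n) with
  | Running C' => round_inv (R + n) C'
  | Returned r => r = zero_forcing_number E
  end.
Proof.
move=> irrE; elim: n => [|n IHn] in R C *; first by rewrite addn0.
move=> invC; rewrite [iota _ _]/=; cbn [foldl].
have := round_invP invC; case: (round _ _ _ _ _) => [C'|r].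
  by rewrite addnS -addSn; apply: IHn.
case=> rR [Z Zzf Zr]; rewrite foldl_returned // /zero_forcing_number.
case: arg_minnP => [|M Mzf minM]; first exact: zero_forcingT.
apply/eqP; rewrite eqn_leq (leq_trans (minM Z Zzf) Zr) andbT.
(* If a minimum zero forcing set had at most [R] vertices, the table before this round would already
   contain [setT]. *)
apply: leq_trans rR _; rewrite ltnNge; apply/negP => MR.
have [vC _ satC C0] := invC.
have [i /vC[_]] := saturated_full irrE satC C0 Mzf MR.
by rewrite eqxx.
Qed.

End Rounds.
End Wavefront.

Theorem theorem1 (V : finType) (E : rel V)
  (E_sym : symmetric E) (E_irr : irreflexive E)
  (V_nonempty : 0 < #|V|)
  (ordC : nat -> seq (entry V) -> seq (entry V))
  (ordV : nat -> entry V -> seq V)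
  (ordC_perm : forall R C, perm_eq (ordC R C) C)
  (ordV_perm : forall R p, perm_eq (ordV R p) (enum V)) :
  wavefront E ordC ordV = Some (zero_forcing_number E).
Proof.
have st0 : stalled E set0 by move=> w; apply/existsP => -[u]; rewrite /forces inE.
have V0 : set0 != [set: V] by rewrite eq_sym -cards_eq0 cardsT -lt0n.
have inv0 : round_inv E 0 [:: (set0, 0)].
  split=> [q|q|S r v|]; rewrite ?mem_head // inE => /eqP.
  - by move->; split=> //; exists set0; rewrite ?cards0 ?cl_stalled_id.
  - by move->.
  - case=> -> -> c0; rewrite (step_set_free st0 c0).
    by exists 0; rewrite ?mem_head.
have := rounds_invP ordC_perm ordV_perm #|V| E_irr inv0; rewrite /wavefront.
case: (foldl _ _ _) => [C [vC _ satC C0] | r -> //].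
(* Without a return, the table is saturated at level [#|V|]; as [setT] is a zero forcing set of that
   size, the table would contain [setT]. *)
have [|i /vC[_]] := saturated_full E_irr satC C0 (zero_forcingT E).
  by rewrite cardsT.
by rewrite eqxx.
Qed.
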